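(* $\chi^\star_\ell(G) \le 2\delta^\star(G)$ for any graph $G$.
   Context: Graphs are finite and simple. The degeneracy $\delta^\star(G)$ is the maximum over all subgraphs $H$ of $G$ of the minimum degree of $H$; equivalently, it is the least $d$ such that the vertices of $G$ can be ordered so that each vertex has at most $d$ neighbours preceding it in the order. A list-assignment $L$ of $G$ maps each vertex $v\in V(G)$ to a set $L(v)\subseteq\mathbb{N}$ of colours; for a positive integer $k$, it is a $k$-list-assignment if $|L(v)|=k$ for every $v$. A proper $L$-colouring is a map $c:V(G)\to\mathbb{N}$ with $c(v)\in L(v)$ for all $v$ and $c(u)\neq c(v)$ for every edge $uv$. A proper $L$-packing of $G$ of size $k$ is a collection of $k$ proper $L$-colourings $c_1,\dots,c_k$ that are mutually disjoint, i.e. $c_i(v)\neq c_j(v)$ for all $i\neq j$ and all $v\in V(G)$. The list (chromatic) packing number $\chi^\star_\ell(G)$ is the least $k$ such that $G$ admits a proper $L$-packing of size $k$ for every $k$-list-assignment $L$ of $G$.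
   Formalization: The graph is assumed to have at least one edge: for an edgeless graph the degeneracy is 0 while the list packing number, a least positive integer, is 1, so the inequality fails there. *)

(* Defs.v *)
From mathcomp Require Import all_boot finmap.
Set Implicit Arguments. Unset Strict Implicit. Unset Printing Implicit Defensive.

Record sgraph := SGraph {
  vertex :> finType;
  adj : rel vertex;
  adj_sym : symmetric adj;
  adj_irr : irreflexive adj
}.

Definition edges (G : sgraph) : {set {set G}} :=
  [set [set p.1; p.2] | p : G * G & adj p.1 p.2].

(* A pair H = (S, F) stands for the graph with vertex set S and edge set F;
   subgraphs are nonempty and need not be induced. *)
Definition subgraph (G : sgraph) (H : {set G} * {set {set G}}) : bool :=
  [&& H.1 != set0, H.2 \subset edges G & cover H.2 \subset H.1].

Definition sub_degree (G : sgraph) (H : {set G} * {set {set G}}) (v : G) : nat :=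
  #|[set u : G | [set v; u] \in H.2]|.

(* The default #|G| is never attained on a subgraph, as degrees are < #|G|. *)
Definition min_degree (G : sgraph) (H : {set G} * {set {set G}}) : nat :=
  \big[minn/#|G|]_(v in H.1) sub_degree H v.

Definition degeneracy (G : sgraph) : nat :=
  \max_(H : {set G} * {set {set G}} | subgraph H) min_degree H.

Definition list_assignment (G : sgraph) := G -> {fset nat}.

Definition k_list_assignment (G : sgraph) (k : nat) (L : list_assignment G) : Prop :=
  forall v, #|` L v| = k.

Definition proper_coloring (G : sgraph) (L : list_assignment G) (c : G -> nat) : Prop :=
  (forall v, c v \in L v) /\ (forall u v, adj u v -> c u <> c v).

Definition proper_packing (G : sgraph) (L : list_assignment G) (k : nat)
    (c : 'I_k -> G -> nat) : Prop :=
  (forall i, proper_coloring L (c i)) /\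
  (forall i j, i <> j -> forall v, c i v <> c j v).

Definition list_packable (G : sgraph) (k : nat) : Prop :=
  forall L : list_assignment G, k_list_assignment k L ->
    exists c : 'I_k -> G -> nat, proper_packing L c.

(* k is the list packing number of G. Candidates are positive: k = 0 would
   vacuously be packable for every G. *)
Definition is_list_packing_number (G : sgraph) (k : nat) : Prop :=
  [/\ 0 < k, list_packable G k &
      forall j, 0 < j -> list_packable G j -> k <= j].

(* Main.v *)
Require Import Defs.
From mathcomp Require Import all_boot finmap.
From mathcomp Require Import fingroup perm zify.
From Stdlib Require Import Classical.

(** Put d := degeneracy G; an edge forces d > 0. It suffices to show that G is
    (2 * d)-packable, because the packing number is then a least element of a
    nonempty set of positive integers.

    The packing is built one vertex at a time, along a degeneracy order:
    [low_degree_vertex] gives, in any nonempty set S of vertices, a vertex v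
    with at most d neighbours in S, and it is enough to extend a packing of
    S minus v to v. Such an extension is a bijection between the k = 2 * d
    colourings and the k colours of L v, subject to forbidden pairs (i, x): the
    colour x is forbidden to the colouring c_i when some neighbour u of v has
    c_i(u) = x. One neighbour u forbids at most one colour to a given c_i, and,
    since the colourings are disjoint at u, forbids a given colour to at most
    one c_i. So every colouring and every colour lies in at most d = k / 2
    forbidden pairs. [avoiding_perm] shows that under this symmetric condition a
    bijection without forbidden pairs exists: a bijection with the fewest
    forbidden pairs can otherwise be improved by a single transposition. *)

(** If [bad x (s x)], the elements y for which [bad x (s y)] and those for which
    [bad y (s x)] number at most #|T| in total, and x is counted twice. Hence
    some y is in neither class; exchanging the values of s at x and y repairs x
    without spoiling y. A permutation with the most good pairs thus has only
    good pairs. *)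
Lemma avoiding_perm (T : finType) (bad : rel T) :
    (forall x, 2 * #|[set y | bad x y]| <= #|T|) ->
    (forall y, 2 * #|[set x | bad x y]| <= #|T|) ->
  exists s : {perm T}, forall x, ~~ bad x (s x).
Proof.
move=> row_bad col_bad.
pose good (s : {perm T}) := [set x | ~~ bad x (s x)].
case: (@arg_maxnP {perm T} 1%g predT (fun s => #|good s|) isT) => s _ s_max.
exists s => x; apply/negP => bad_x.
pose A := [set y | bad x (s y)]; pose B := [set y | bad y (s x)].
have cardA : 2 * #|A| <= #|T|.
  rewrite -(card_imset A (@perm_inj _ s)); apply: leq_trans (row_bad x).
  rewrite leq_mul2l subset_leq_card //.
  by apply/subsetP => _ /imsetP[y yA ->]; rewrite !inE in yA *.
have cardB : 2 * #|B| <= #|T| := col_bad (s x).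
have AB_pos : 0 < #|A :&: B| by apply/card_gt0P; exists x; rewrite !inE bad_x.
have cardC : 0 < #|~: (A :|: B)|.
  have := cardsUI A B; have := cardsC (A :|: B); lia.
have [y] := card_gt0P cardC; rewrite !inE negb_or => /andP[y_x x_y].
have yx : y != x by apply: contraNneq y_x => ->.
pose s' := (tperm x y * s)%g.
have s'E z : s' z = s (tperm x y z) by rewrite permM.
have /subset_leq_card : x |: good s \subset good s'.
  apply/subsetP => z; rewrite !inE s'E.
  by case: tpermP => [-> _|-> _|/eqP/negPf-> _].
rewrite cardsU1 inE bad_x /= => lt_good.
by have := s_max s' isT; rewrite /=; lia.
Qed.

Lemma card_exists_functional (U T : finType) (N : {set U}) (P : U -> pred T) :
    (forall u x y, u \in N -> P u x -> P u y -> x = y) ->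
  #|[set x | [exists u in N, P u x]]| <= #|N|.
Proof.
move=> P_fun.
have -> : [set x | [exists u in N, P u x]] = \bigcup_(u in N) [set x | P u x].
  apply/setP => x; rewrite inE; apply/exists_inP/bigcupP => -[u uN Pux];
    by exists u; rewrite // inE in Pux *.
rewrite -(sum1_card (mem N)).
apply: (@big_rec2 _ _ (fun (A : {set T}) n => #|A| <= n)) => [|u A n uN leA].
  by rewrite cards0.
rewrite (leq_trans (leq_card_setU _ _)) // leq_add //.
by apply/card_le1_eqP => x y; rewrite !inE => Px Py; apply: (P_fun u).
Qed.

(** The subgraph induced on S has minimum degree at most the degeneracy. *)
Lemma low_degree_vertex {G : sgraph} {S : {set G}} : S != set0 ->
  exists2 v, v \in S & #|[set u in S | adj v u]| <= degeneracy G.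
Proof.
move=> S_nz; pose H := (S, [set e in edges G | e \subset S]).
have subH : subgraph H.
  rewrite /subgraph /= S_nz /=; apply/andP; split.
    by apply/subsetP => e; rewrite inE => /andP[].
  by apply/bigcupsP => e; rewrite inE => /andP[].
have minH : min_degree H <= degeneracy G by apply: leq_bigmax_cond.
have [v vS le_v] : exists2 v, v \in S & sub_degree H v <= min_degree H.
  (* The minimum is attained, or it is the default value, which bounds every degree. *)
  rewrite /min_degree; have : H.1 = S by [].
  elim/big_rec: _ => [|w m wS IH] defS.
    by have [v vS] := set0Pn _ S_nz; exists v => //; apply: max_card.
  have [v vS le_v] := IH defS.
  case: (leqP (sub_degree H w) m) => _; last by exists v.
  by exists w; rewrite // -defS.
exists v => //; apply: leq_trans (leq_trans le_v minH).
apply/subset_leq_card/subsetP => u; rewrite !inE => /andP[uS vu].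
apply/andP; split; last by rewrite subUset !sub1set vS.
apply: (imset_f (fun p : G * G => [set p.1; p.2]) (x := (v, u))).
by rewrite inE.
Qed.

Lemma degeneracy_gt0 {G : sgraph} {u v : G} : adj u v -> 0 < degeneracy G.
Proof.
move=> uv; have uS : [set u; v] != set0 by apply/set0Pn; exists u; rewrite set21.
have [w + le_w] := low_degree_vertex uS.
move=> wS; apply: leq_trans le_w; apply/card_gt0P.
have /set2P[->|->] := wS; [exists v | exists u];
  by rewrite !inE eqxx ?orbT //= adj_sym.
Qed.

Definition packing_on {G : sgraph} (L : list_assignment G) {k : nat}
    (S : {set G}) (c : 'I_k -> G -> nat) : Prop :=
  [/\ forall i v, v \in S -> c i v \in L v,
      forall i u v, u \in S -> v \in S -> adj u v -> c i u <> c i v &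
      forall i j v, v \in S -> c i v = c j v -> i = j].

(** A pair (i, x) of a colouring and a position in the list of v is bad when c i
    takes the x-th colour of L v at a neighbour of v. Each neighbour makes at most
    one pair bad in every row, as the colours of L v are distinct, and in every
    column, as the colourings are disjoint; so [avoiding_perm] applies. *)
Lemma packing_on_extend {G : sgraph} {L : list_assignment G} {k : nat}
    {S : {set G}} {v : G} {c : 'I_k -> G -> nat} :
    #|` L v| = k -> v \in S -> 2 * #|[set u in S | adj v u]| <= k ->
    packing_on L (S :\ v) c ->
  exists c' : 'I_k -> G -> nat, packing_on L S c'.
Proof.
move=> sizeL vS degv [cL c_proper c_disj].
pose N := [set u in S | adj v u]; pose col (x : 'I_k) := nth 0 (L v) x.
have N_S u : u \in N -> u \in S :\ v.
  rewrite !inE => /andP[-> vu]; rewrite andbT.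
  by apply: contraTneq vu => ->; rewrite adj_irr.
have colL x : col x \in L v by rewrite mem_nth // sizeL.
have col_inj : injective col.
  move=> x y /eqP; rewrite nth_uniq ?sizeL ?fset_uniq // => /eqP.
  exact: val_inj.
pose bad := [rel i x | [exists u in N, c i u == col x]].
have [||s s_ok] := avoiding_perm _ bad; try rewrite card_ord.
- move=> i; apply: leq_trans degv; rewrite leq_mul2l /=.
  apply: (card_exists_functional _ _ N (fun u x => c i u == col x)).
  by move=> u x y _ /eqP-> /eqP /col_inj.
- move=> x; apply: leq_trans degv; rewrite leq_mul2l /=.
  apply: (card_exists_functional _ _ N (fun u i => c i u == col x)).
  by move=> u i j uN /eqP <- /eqP /esym; apply: c_disj; apply: N_S.
have s_proper i u : u \in S -> adj v u -> c i u <> col (s i).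
  move=> uS vu cu; have /existsP[] := s_ok i; exists u.
  by rewrite inE uS vu cu /=.
exists (fun i u => if u == v then col (s i) else c i u); split.
- move=> i u uS; case: eqVneq => [-> //|uv].
  by apply: cL; rewrite !inE uv.
- move=> i u w uS wS uw.
  case: (eqVneq u v) => [eu|uv]; case: (eqVneq w v) => [ew|wv].
  + by rewrite eu ew adj_irr in uw.
  + by apply/nesym/s_proper; rewrite // -eu.
  + by apply: s_proper; rewrite // adj_sym -ew.
  + by apply: c_proper; rewrite // !inE ?uv ?wv.
- move=> i j u uS; case: eqVneq => [_ /col_inj /perm_inj //|uv].
  by apply: c_disj; rewrite !inE uv.
Qed.

Lemma packing_on_exists {G : sgraph} {L : list_assignment G} {k : nat}
    (S : {set G}) :
    k_list_assignment k L -> 2 * degeneracy G <= k ->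
  exists c : 'I_k -> G -> nat, packing_on L S c.
Proof.
move=> sizeL le_k.
elim: {S}_.+1 {-2}S (ltnSn #|S|) => // n IHn S; rewrite ltnS => le_S.
have [->|S_nz] := eqVneq S set0.
  by exists (fun _ _ => 0); split=> [i v|i u v|i j v]; rewrite inE.
have [v vS deg_v] := low_degree_vertex S_nz.
have [|c c_pack] := IHn (S :\ v).
  by apply: leq_trans le_S; rewrite (cardsD1 v S) vS.
apply: packing_on_extend c_pack => //.
by apply: leq_trans le_k; rewrite leq_mul2l.
Qed.

Lemma list_packable_degeneracy (G : sgraph) (k : nat) :
  2 * degeneracy G <= k -> list_packable G k.
Proof.
move=> le_k L sizeL.
have [c [cL c_proper c_disj]] := packing_on_exists [set: G] sizeL le_k.
exists c; split=> [i|i j neq_ij v /c_disj eq_ij].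
  split=> [v|u v]; first by apply: cL; rewrite inE.
  by apply: c_proper; rewrite inE.
by apply/neq_ij/eq_ij; rewrite inE.
Qed.

(** Packability is not a boolean predicate, so the least element is found by
    classical reasoning. *)
Lemma is_list_packing_number_exists (G : sgraph) (n : nat) :
    0 < n -> list_packable G n ->
  exists k, is_list_packing_number G k /\ k <= n.
Proof.
elim/ltn_ind: n => n IHn n_gt0 packn.
have [[j [lt_jn j_gt0 packj]]|no_j] :=
    classic (exists j, [/\ j < n, 0 < j & list_packable G j]).
  have [k [packk le_kj]] := IHn j lt_jn j_gt0 packj.
  by exists k; split=> //; apply: leq_trans le_kj (ltnW lt_jn).
exists n; split=> //; split=> // j j_gt0 packj.
by rewrite leqNgt; apply/negP => lt_jn; apply: no_j; exists j.
Qed.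

Theorem theorem3 (G : sgraph) (G_edge : exists u v : G, adj u v) :
  exists k : nat, is_list_packing_number G k /\ k <= 2 * degeneracy G.
Proof.
have [u [v /degeneracy_gt0 d_gt0]] := G_edge.
apply: is_list_packing_number_exists; first by rewrite muln_gt0.
exact: list_packable_degeneracy.
Qed.
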